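(* Let $F$ be an algebraically closed field with $\mathrm{char}\,F\neq 2,3$, let $\lambda\in F$ be nonzero, and let $J_n(f)$ ($n\ge 3$) be the $n$-dimensional simple Jordan algebra of a nondegenerate symmetric bilinear form $f$ over $F$. Then $$\mathrm{rb}_\lambda(J_n(f))=\begin{cases}2,& n\text{ is odd},\\ 3,& n\text{ is even}.\end{cases}$$
   Context: For a vector space $V$ over $F$ with $\dim V=n-1>1$ and a nondegenerate symmetric bilinear form $f$ on $V$, $J_n(f)=F1\oplus V$ (direct sum of vector spaces) with product $(\alpha\cdot1+a)(\beta\cdot1+b)=(\alpha\beta+f(a,b))\cdot1+(\alpha b+\beta a)$ for $\alpha,\beta\in F$, $a,b\in V$. For an algebra $A$ over $F$ (not necessarily associative) and $\lambda\in F$, a linear operator $R\colon A\to A$ is a Rota--Baxter operator of weight $\lambda$ if $R(x)R(y)=R(R(x)y+xR(y)+\lambda xy)$ for all $x,y\in A$. The Rota--Baxter $\lambda$-index of $A$ is $$\mathrm{rb}_\lambda(A)=\min\{m\in\mathbb N\mid \text{for every Rota--Baxter operator } R \text{ of weight }\lambda\text{ on }A\text{ there exists } 0\le k\le m \text{ with } R^k(R+\lambda\,\mathrm{id})^{m-k}=0\},$$ and $\mathrm{rb}_\lambda(A)=\infty$ if no such $m$ exists. *)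

(* Defs.v *)
From HB Require Import structures.
From mathcomp Require Import all_boot all_order all_algebra.
From mathcomp Require Import sesquilinear boolp.

Set Implicit Arguments.
Unset Strict Implicit.
Unset Printing Implicit Defensive.

Import GRing.Theory.
Local Open Scope ring_scope.

(* A not necessarily associative algebra over F is an F-module A together with
   a bilinear product mul : A -> A -> A. *)

Definition rota_baxter (F : fieldType) (A : lmodType F)
    (mul : {bilinear A -> A -> A}) (lam : F) (R : {linear A -> A}) : Prop :=
  forall x y : A,
    mul (R x) (R y) = R (mul (R x) y + mul x (R y) + lam *: mul x y).

Definition rb_bound (F : fieldType) (A : lmodType F)
    (mul : {bilinear A -> A -> A}) (lam : F) (m : nat) : Prop :=
  forall R : {linear A -> A}, rota_baxter mul lam R ->
    exists2 k : nat, (k <= m)%N &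
      forall x : A, iter k R (iter (m - k) (fun y => R y + lam *: y) x) = 0.

Lemma rb_bound_asbool (F : fieldType) (A : lmodType F)
    (mul : {bilinear A -> A -> A}) (lam : F) :
  (exists m, rb_bound mul lam m) -> exists m, `[< rb_bound mul lam m >].
Proof. by case=> m Hm; exists m; apply/asboolP. Qed.

(* Values in option nat: Some m is a finite index, None stands for infinity. *)
Definition rb_index (F : fieldType) (A : lmodType F)
    (mul : {bilinear A -> A -> A}) (lam : F) : option nat :=
  if pselect (exists m, rb_bound mul lam m) is left e
  then Some (ex_minn (rb_bound_asbool e)) else None.

Section JordanAlgebra.
Variables (F : fieldType) (V : vectType F) (f : {symmetric V}).

(* F^o is F as a module over itself, so that (alpha, a) : F^o * V stands for
   alpha 1 + a. *)
Definition jordan_mul (x y : F^o * V) : F^o * V :=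
  (x.1 * y.1 + f x.2 y.2, x.1 *: y.2 + y.1 *: x.2).

Lemma jordan_mul_bilinear : bilinear_for *:%R *:%R jordan_mul.
Proof.
split=> [y|x] a u v; apply: injective_projections; rewrite /jordan_mul /=.
- rewrite linearPl.
  rewrite [LHS](_ : _ = (a * u.1 + v.1) * y.1 + (a * f u.2 y.2 + f v.2 y.2)) //.
  rewrite [RHS](_ : _ = a * (u.1 * y.1 + f u.2 y.2) + (v.1 * y.1 + f v.2 y.2)) //.
  by rewrite mulrDl mulrDr mulrA addrACA.
- rewrite [RHS](_ : _ = a *: (u.1 *: y.2 + y.1 *: u.2)
                        + (v.1 *: y.2 + y.1 *: v.2)) //.
  by rewrite scalerDl !scalerDr !scalerA [y.1 * a]mulrC addrACA.
- rewrite linearPr.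
  rewrite [LHS](_ : _ = x.1 * (a * u.1 + v.1) + (a * f x.2 u.2 + f x.2 v.2)) //.
  rewrite [RHS](_ : _ = a * (x.1 * u.1 + f x.2 u.2) + (x.1 * v.1 + f x.2 v.2)) //.
  by rewrite !mulrDr mulrCA addrACA.
- rewrite [RHS](_ : _ = a *: (x.1 *: u.2 + u.1 *: x.2)
                        + (x.1 *: v.2 + v.1 *: x.2)) //.
  by rewrite scalerDl !scalerDr !scalerA [x.1 * a]mulrC addrACA.
Qed.

HB.instance Definition _ :=
  bilinear_isBilinear.Build F (F^o * V)%type (F^o * V)%type (F^o * V)%type
    *:%R *:%R jordan_mul jordan_mul_bilinear.

End JordanAlgebra.

(* Main.v *)
From HB Require Import structures.
Require Import Defs.
From mathcomp Require Import all_boot all_order all_algebra.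
From mathcomp Require Import ring zify.
From mathcomp Require Import sesquilinear boolp.

Set Implicit Arguments.
Unset Strict Implicit.
Unset Printing Implicit Defensive.

Import GRing.Theory.
Local Open Scope ring_scope.

(* Put S = R + lam. Both R and S are morphisms for the product
   x o y = R x * y + x * S y, so ker R is an ideal of im S and ker S one of
   im R. If R 1 is a scalar then 1 lies in one of the kernels and R S = 0.
   Otherwise R 1 = a + v with v != 0, and the identity on the span of 1 and v
   forces f v v = lam^2 / 4 and a = -lam/2, lam/2 or -3lam/2. In each case
   1/2 + v/lam is in ker R or 1/2 - v/lam is in ker S. An ideal of a
   subalgebra B that contains some 1/2 + u has B inside it modulo F 1, so
   im (R S) is spanned by a single vector, R 1 or S 1, which is killed by R or
   by S. Hence the bound 3.

   A subalgebra without 1 is totally isotropic for the norm a^2 - f v v, so if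
   im S and ker S (of complementary dimensions) both miss 1, then n is even.
   For n odd, 1 is thus in im R and in im S, hence in im (R S), unless R S = 0;
   but im (R S) is spanned by a single non-scalar vector.

   The lower bounds come from -lam times the projection onto the line of an
   idempotent (all n) and, for n even, from an operator built on the
   projection P of v^perp onto a Lagrangian along a Lagrangian. *)

(** * Rota-Baxter operators and their shift by [lam] *)

Section RotaBaxterShift.
Variables (F : fieldType) (A : lmodType F) (mul : {bilinear A -> A -> A}).
Variables (lam : F) (R : {linear A -> A}).

Definition rb_shift : {linear A -> A} := R \+ lam \*: idfun.

Lemma rb_shiftE x : rb_shift x = R x + lam *: x. Proof. by []. Qed.

Local Notation S := rb_shift.

Lemma rb_shift_comm x : R (S x) = S (R x).
Proof. by rewrite !rb_shiftE linearD linearZ. Qed.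

(** Since [S - R] is multiplication by the invertible [lam], the images of [R] and [S] meet only in
    the image of [R S]. *)
Lemma rb_image_cap x y : lam != 0 -> R x = S y -> exists w, R x = R (S w).
Proof.
move=> lam0 e; exists (lam^-1 *: (x - y)).
rewrite e rb_shift_comm; congr (S _).
rewrite linearZ_LR linearB e rb_shiftE [X in _ *: X]addrC addKr.
by rewrite scalerA mulVf // scale1r.
Qed.

Hypothesis RB : rota_baxter mul lam R.

(** Putting [S] on one factor absorbs the weight term, so that one product serves both [R] and
    [S]. *)
Definition rb_dot x y := mul (R x) y + mul x (S y).

Lemma rb_dotR x y : mul (R x) (R y) = R (rb_dot x y).
Proof.
by rewrite RB /rb_dot rb_shiftE linearDr /= linearZr_LR addrA.
Qed.

Lemma rb_dotS x y : mul (S x) (S y) = S (rb_dot x y).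
Proof.
rewrite [in RHS]rb_shiftE -rb_dotR /rb_dot !rb_shiftE linearDl /= !linearDr /=.
by rewrite !linearZl_LR /= !linearZr_LR /= !scalerDr -!addrA.
Qed.

Lemma ker_rb_ideal x y : R x = 0 -> R (mul x (S y)) = 0.
Proof. by move=> x0; have := rb_dotR x y; rewrite /rb_dot x0 !linear0l add0r. Qed.

Lemma ker_shift_ideal x y : S x = 0 -> S (mul (R y) x) = 0.
Proof. by move=> x0; have := rb_dotS y x; rewrite /rb_dot x0 !linear0r addr0. Qed.

End RotaBaxterShift.

(** * The Jordan product and multiplication by 1/2 + u *)

Section JordanProduct.
Variables (F : fieldType) (V : vectType F) (f : {symmetric V}).
Local Notation J := (F^o * V)%type.
Local Notation mul := (jordan_mul f).
Local Notation jone := ((1, 0) : J).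

Lemma symC u v : f u v = f v u.
Proof. by rewrite hermC expr0 mul1r. Qed.

Lemma mulJ1 x : mul x jone = x.
Proof.
case: x => a u; rewrite /jordan_mul /= linear0r scaler0 add0r scale1r addr0.
by rewrite mulr1.
Qed.

Lemma mul1J x : mul jone x = x.
Proof.
case: x => a u; rewrite /jordan_mul /= linear0l scaler0 addr0 scale1r addr0.
by rewrite mul1r.
Qed.

Lemma mulJC x y : mul x y = mul y x.
Proof.
rewrite /jordan_mul symC addrC [X in (X, _)]addrC mulrC addrC.
by rewrite [X in (_, X)]addrC.
Qed.

Hypothesis two_neq0 : (2 : F) != 0.

(* Since e * y = y / 2 + y.1 e - (y.1 / 2 - f u y.2) 1 for every y. *)
Lemma lin_on_absorbed (T : {linear J -> J}) (u : V) (y : J) :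
  let e : J := (2^-1, u) in
  T e = 0 -> T (mul e y) = 0 -> T y = ((y.1 : F) - 2 * f u y.2) *: T jone.
Proof.
case: y => b w /= Te.
have -> : mul (2^-1, u) (b, w) =
    (2^-1 : F) *: ((b, w) : J) + (b : F) *: ((2^-1, u) : J)
    - (2^-1 * (b - 2 * f u w)) *: jone.
  apply: injective_projections => /=; last by rewrite scaler0 subr0.
  rewrite /GRing.scale /=; move: (f u w) (b : F) two_neq0 => t b' h.
  have h' : (2^-1 : F) * 2 = 1 by rewrite mulVf.
  by field.
rewrite linearB linearD !(linearZ_LR T) Te scaler0 addr0 => /eqP.
rewrite subr_eq0 -scalerA => /eqP/scalerI; apply; exact: invr_neq0.
Qed.

End JordanProduct.

(** * The image of 1 and the image of [R S] *)

Section ImageOfOne.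
Variables (F : fieldType) (V : vectType F) (f : {symmetric V}).
Local Notation J := (F^o * V)%type.
Local Notation mul := (jordan_mul f).
Local Notation jone := ((1, 0) : J).

Hypothesis two_neq0 : (2 : F) != 0.
Variables (lam : F) (lam_neq0 : lam != 0) (R : {linear J -> J}).
Hypothesis RB : rota_baxter mul lam R.
Local Notation S := (rb_shift lam R).

Lemma four_neq0 : (4 : F) != 0.
Proof. by rewrite (_ : 4 = 2 * 2) ?mulf_neq0 //; ring. Qed.

(* Applying R to 1 * 1 and 1 * v gives f v v and a cubic in a, which factors
   as (2a + lam)(2a - lam)(2a + 3 lam). *)
Lemma rb_image_one (a : F) (v : V) : R jone = (a, v) -> v != 0 ->
  exists2 c : F, R (0, v) = (c, - (lam / 2) *: v) &
    [/\ 2 * c = lam ^+ 2 / 4 - a ^+ 2 - lam * a, f v v = lam ^+ 2 / 4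
      & [|| a == - lam / 2, a == lam / 2 | a == - 3 * lam / 2]].
Proof.
move=> R1 v0.
pose em (p q : F) : J := (p, q *: v).
have emD p q p' q' : em p q + em p' q' = em (p + p') (q + q').
  by apply: injective_projections; rewrite //= scalerDl.
have emZ k p q : k *: em p q = em (k * p) (k * q).
  by apply: injective_projections; rewrite //= scalerA.
have emM p q p' q' : mul (em p q) (em p' q') =
    em (p * p' + q * q' * f v v) (p * q' + p' * q).
  apply: injective_projections => /=; last by rewrite !scalerA scalerDl.
  by rewrite linearZl_LR /= linearZr_LR /= mulrA.
have emI p q p' q' : em p q = em p' q' -> p = p' /\ q = q'.
  by case=> -> /eqP; rewrite -subr_eq0 -scalerBl scaler_eq0 (negPf v0) orbF
    subr_eq0 => /eqP.
have one : jone = em 1 0 by rewrite /em scale0r.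
have R1e : R (em 1 0) = em a 1 by rewrite /em scale0r scale1r.
set s : F := f v v in emM *.
pose c := (s - a ^+ 2 - lam * a) / 2.
have emR p q : em p q = p *: em 1 0 + q *: em 0 1.
  by rewrite !emZ emD !(mulr0, mulr1) addr0 add0r.
have hom x y : mul (R x) (R y) = R (mul (R x) y + mul x (S y)) := rb_dotR RB x y.
have Re p q : R (em p q) = p *: em a 1 + q *: R (em 0 1).
  by rewrite emR linearD !(linearZ_LR R) R1e.
have mule1 x : mul x (em 1 0) = x by rewrite -one mulJ1.
have mul1e x : mul (em 1 0) x = x by rewrite -one mul1J.
(* The identity at (1, 1) reads R1 * R1 = (2a + lam) R1 + 2 Rv and is solved for Rv. *)
have Rv : R (em 0 1) = em c (- (lam / 2)).
  have := hom (em 1 0) (em 1 0).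
  rewrite mule1 mul1e rb_shiftE !R1e emM emZ !emD Re emZ => e.
  apply: (scalerI two_neq0); rewrite emZ.
  have <- : 1 + (1 + lam * 0) = 2 :> F by ring.
  rewrite -[LHS](addKr (em ((a + (a + lam * 1)) * a) ((a + (a + lam * 1)) * 1))) -e.
  rewrite -scaleN1r emZ emD /c; congr em; first by field.
  by field.
(* The coordinate along [v] gives [s]; the one along 1 gives (a + lam/2)(s + c) = 0, the cubic in
   [a]. *)
have := hom (em 1 0) (em 0 1).
rewrite mul1e rb_shiftE R1e Rv !emM !emZ !emD Re Rv !emZ emD.
case/emI=> E1 E2.
have {}E2 : s = lam ^+ 2 / 4.
  apply/eqP; rewrite -subr_eq0; apply/eqP.
  rewrite -(subrr (a * - (lam / 2) + c * 1)) [X in _ = X - _]E2.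
  by field; rewrite two_neq0 four_neq0.
exists c; first by rewrite -[v in LHS]scale1r.
split=> //; first by rewrite /c E2; field; rewrite two_neq0 four_neq0.
have : (a - - lam / 2) * (a - lam / 2) * (a - -3 * lam / 2) == 0.
  move/eqP: E1; rewrite -subr_eq0 /c E2; set d := _ - _ => /eqP d0.
  by apply/eqP; rewrite -[RHS](mulr0 2) -d0 /d; field; rewrite two_neq0 four_neq0.
by rewrite !mulf_eq0 !subr_eq0 -orbA.
Qed.

(** The generator is [R 1] or [S 1]. That it lies in a kernel yields the bound 3; that it is not a
    scalar serves the case of odd n. *)
Lemma rb_comp_in_line :
  (forall x, R (S x) = 0) \/
  exists2 u : J, u.2 != 0 /\ (R u = 0 \/ S u = 0) &
                 forall x, exists k : F, R (S x) = k *: u.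
Proof.
have ideR (x y : J) : R x = 0 -> R (mul x (S y)) = 0 by exact: ker_rb_ideal.
have ideS (x y : J) : S x = 0 -> S (mul x (R y)) = 0.
  by rewrite mulJC; exact: ker_shift_ideal.
have [a [v R1]] : exists (a : F) (v : V), R jone = (a, v).
  by exists (R jone).1, (R jone).2; case: (R jone).
have [v0|v0] := eqVneq v 0.
  left=> x.
  have aR : R jone = (a : F) *: jone.
    rewrite R1 v0; apply: injective_projections; rewrite /= ?scaler0 //.
    by rewrite /GRing.scale /= mulr1.
  (* The identity at (1, 1) reads a^2 = (2a + lam) a. *)
  have : (a : F) * (a + lam) = 0.
    have : mul (R jone) (R jone) = R (mul (R jone) jone + mul jone (S jone)).
      exact: (rb_dotR RB).
    rewrite mulJ1 mul1J rb_shiftE aR.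
    have -> : mul (a *: jone) (a *: jone) = ((a : F) * a) *: jone.
      have -> : mul (a *: jone) (a *: jone) = (a : F) *: mul jone (a *: jone).
        exact: linearZl_LR.
      by rewrite mul1J scalerA.
    rewrite -!scalerDl (linearZ_LR R) aR scalerA => /(congr1 fst) /=.
    rewrite /GRing.scale /= !mulr1 => E.
    apply: (addIr ((a : F) * a)); rewrite add0r [RHS]E.
    by move: (a : F) => b; ring.
  (* Thus 1 lies in ker R or in ker S, and that kernel absorbs products with the image of the other
     operator. *)
  move/eqP; rewrite mulf_eq0 => /orP[]/eqP a0.
    by rewrite -[S x](mul1J f) ideR // aR a0 scale0r.
  rewrite rb_shift_comm -[R x](mul1J f) ideS // rb_shiftE aR -scalerDl.
  by rewrite a0 scale0r.
right; have [c Rv [Ec Es aP]] := rb_image_one R1 v0.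
have S1 : S jone = (a + lam, v).
  rewrite rb_shiftE R1; apply: injective_projections => /=.
    by rewrite /GRing.scale /= mulr1.
  by rewrite scaler0 addr0.
have Rem (p q : F) : R (p, q *: v) = (p * a + q * c, (p - q * (lam / 2)) *: v).
  have -> : (p, q *: v) = p *: jone + q *: ((0, v) : J).
    apply: injective_projections => /=; last by rewrite scaler0 add0r.
    by rewrite /GRing.scale /= mulr1 mulr0 addr0.
  rewrite linearD !(linearZ_LR R) R1 Rv; apply: injective_projections => //=.
  by rewrite scalerDl scalerA mulrN.
have Sem (p q : F) : S (p, q *: v) =
    (p * a + q * c + lam * p, (p - q * (lam / 2) + lam * q) *: v).
  rewrite rb_shiftE Rem; apply: injective_projections => //=.
  by rewrite [RHS]scalerDl scalerA.
have {}Ec : c = (lam ^+ 2 / 4 - a ^+ 2 - lam * a) / 2.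
  by rewrite -Ec mulrAC mulfV // mul1r.
have zero (p q : F) : p = 0 -> q = 0 -> (p, q *: v) = 0 :> J.
  by move=> -> ->; rewrite scale0r.
have caseR : a ^+ 2 = lam ^+ 2 / 4 -> R (R jone) = 0 \/ S (R jone) = 0 ->
    exists2 u : J, u.2 != 0 /\ (R u = 0 \/ S u = 0) &
                   forall x, exists k : F, R (S x) = k *: u.
  move=> a2 RSu; exists (R jone) => [|x]; first by rewrite R1 in RSu *.
  (* Here c = -lam a / 2, which cancels the scalar part. *)
  have e0 : R (2^-1, lam^-1 *: v) = 0.
    by rewrite Rem Ec a2; apply: zero; field; rewrite ?lam_neq0 ?two_neq0 ?four_neq0.
  eexists; apply: (lin_on_absorbed two_neq0 e0); exact: ideR.
have caseS : (a + lam) ^+ 2 = lam ^+ 2 / 4 -> R (S jone) = 0 \/ S (S jone) = 0 ->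
    exists2 u : J, u.2 != 0 /\ (R u = 0 \/ S u = 0) &
                   forall x, exists k : F, R (S x) = k *: u.
  move=> a2 RSu; exists (S jone) => [|x]; first by rewrite S1 in RSu *.
  (* Here c = lam (a + lam) / 2, with the same effect. *)
  have e0 : S (2^-1, (- lam^-1) *: v) = 0.
    by rewrite Sem Ec -a2; apply: zero; field; rewrite ?lam_neq0 ?two_neq0 ?four_neq0.
  eexists; rewrite rb_shift_comm; apply: (lin_on_absorbed two_neq0 e0); exact: ideS.
case/or3P: aP => /eqP Ea.
- apply: caseR; first by rewrite Ea; field; rewrite two_neq0 four_neq0.
  right; rewrite R1 -[v]scale1r Sem Ec Ea.
  by apply: zero; field; rewrite two_neq0 ?four_neq0.
- apply: caseR; first by rewrite Ea; field; rewrite two_neq0 four_neq0.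
  left; rewrite R1 -[v]scale1r Rem Ec Ea.
  by apply: zero; field; rewrite two_neq0 ?four_neq0.
- apply: caseS; first by rewrite Ea; field; rewrite two_neq0 four_neq0.
  right; rewrite S1 -[v]scale1r Sem Ec Ea.
  by apply: zero; field; rewrite two_neq0 ?four_neq0.
Qed.
End ImageOfOne.

(** * Subalgebras without 1 *)

Section Isotropic.
Variables (F : fieldType) (V : vectType F) (f : {symmetric V}).
Local Notation J := (F^o * V)%type.
Local Notation mul := (jordan_mul f).
Local Notation jone := ((1, 0) : J).
Hypothesis two_neq0 : (2 : F) != 0.

(** Every x = a + u satisfies x^2 - 2a x + (a^2 - f u u) 1 = 0, so an element of [B] of nonzero norm
    would put 1 in [B]. Polarising the norm then uses that 2 is invertible. *)
Lemma subalgebra_isotropic (B : J -> Prop) :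
    (forall x y, B x -> B y -> B (x + y)) ->
    (forall (a : F) x, B x -> B (a *: x)) ->
    (forall x y, B x -> B y -> B (mul x y)) ->
  ~ B jone -> forall x y, B x -> B y -> (x.1 : F) * y.1 = f x.2 y.2.
Proof.
move=> BD BZ BM B1.
have sq x : B x -> (x.1 : F) * x.1 = f x.2 x.2.
  move=> Bx; apply/eqP; rewrite -subr_eq0; apply/negPn/negP => nz.
  apply: B1; set d : F := _ - _ in nz.
  have -> : jone = - d^-1 *: (mul x x + (- 2 * (x.1 : F)) *: x).
    case: x Bx @d nz => a u Bx d nz; apply: injective_projections => /=.
      rewrite /d /= in nz *; rewrite /GRing.scale /=.
      by move: (a : F) (f u u) nz => b t nz; field; rewrite nz.
    by rewrite -scalerDl -scalerDl mulNr mulr_natl mulr2n subrr scale0r scaler0.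
  by apply: (BZ); apply: (BD); [apply: (BM) | apply: (BZ)].
move=> x y Bx By; have := sq _ (BD _ _ Bx By).
rewrite /= linearDl !linearDr /= -(sq _ Bx) -(sq _ By) (symC f y.2).
move: (f _ _) (x.1 : F) (y.1 : F) => t a b E.
apply: (mulfI two_neq0).
have -> : 2 * (a * b) = (a + b) * (a + b) - a * a - b * b by ring.
by rewrite E; ring.
Qed.

End Isotropic.

(** * Orthonormal bases over an algebraically closed field *)

Section Orthonormal.
Variables (F : closedFieldType) (V : vectType F) (f : {symmetric V}).
Hypotheses (two_neq0 : (2 : F) != 0) (f_nondeg : nondegenerate f).

Lemma sqrt_exists (a : F) : exists b : F, b * b = a.
Proof.
(* [nth] returns its default 0 in degree 1, so the equation solved is b^2 = a. *)
have [b E] := @solve_monicpoly F 2 (nth 0 [:: a]) isT.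
exists b; move: E; rewrite expr2 => ->.
by rewrite !big_ord_recl big_ord0 /= expr0 mulr1 mul0r !addr0.
Qed.

Lemma radical_eq0 u : (forall v, f u v = 0) -> u = 0.
Proof.
move=> fu; apply/eqP; rewrite -memv0 -(eqP f_nondeg).
by apply/mem_orthovP => v _; exact: fu.
Qed.

(** A Gram-Schmidt step: the residues [x - E x] are orthogonal to [s], one of them is anisotropic,
    and a square root normalises it. *)
Lemma orthonormal_extend (s : seq V) : (size s < \dim {:V})%N ->
  (forall i j, (i < size s)%N -> (j < size s)%N -> f s`_i s`_j = (i == j)%:R) ->
  exists u, f u u = 1 /\ forall i, (i < size s)%N -> f u s`_i = 0.
Proof.
move=> ltsN on.
pose E x := \sum_(i < size s) f x s`_i *: s`_i.
have ortho x i : (i < size s)%N -> f (x - E x) s`_i = 0.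
  move=> lti; rewrite linearBl linear_sumlz /= (bigD1 (Ordinal lti)) //=.
  rewrite linearZl_LR /= on // eqxx mulr1 big1 ?addr0 ?subrr // => j.
  by rewrite -val_eqE /= linearZl_LR /= on // => /negPf->; rewrite mulr0.
have [x xs] : exists x, x \notin <<s>>%VS.
  apply: contrapT => /forallNP all_s; move: ltsN; rewrite ltnNge => /negP; apply.
  apply: leq_trans (dim_span s); apply: dimvS; apply/subvP => x _.
  by have /negP := all_s x; rewrite negbK.
pose u := x - E x.
have u0 : u != 0.
  apply: contra xs; rewrite subr_eq0 => /eqP->; apply: memv_suml => i _.
  by apply: memvZ; apply: memv_span; apply: mem_nth.
(* Otherwise polarisation makes all residues orthogonal to each other, and the nonzero [u], being
   orthogonal to the span of [s] as well, would lie in the radical. *)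
have : exists t, f (t - E t) (t - E t) != 0.
  apply: contrapT => /forallNP sq; move/negP: u0; apply; apply/eqP.
  have {}sq t : f (t - E t) (t - E t) = 0.
    by have /negP := sq t; rewrite negbK => /eqP.
  apply: radical_eq0 => y.
  have EB t t' : (t + t') - E (t + t') = (t - E t) + (t' - E t').
    rewrite addrACA -opprD; congr (_ - _); rewrite /E -big_split /=.
    by apply: eq_bigr => i _; rewrite linearDl scalerDl.
  have fuE : f u (E y) = 0.
    rewrite linear_sumr big1 //= => i _.
    by rewrite linearZr_LR /= ortho ?mulr0.
  rewrite -[y](subrK (E y)) linearDr /= fuE addr0.
  rewrite -/u; have := sq (x + y); rewrite EB -/u.
  have := sq y; have := sq x; rewrite -/u; move: (y - E y) => v.
  clearbody u => uu vv.
  rewrite linearDl !linearDr /= uu vv add0r addr0.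
  rewrite (symC f v) -mulr2n -mulr_natl => /eqP.
  by rewrite mulf_eq0 (negPf two_neq0) => /eqP.
case=> t nz; have [b Eb] := sqrt_exists (f (t - E t) (t - E t))^-1.
exists (b *: (t - E t)); split=> [|i lti].
  by rewrite linearZl_LR linearZr_LR /= mulrA Eb mulVf.
by rewrite linearZl_LR /= ortho ?mulr0.
Qed.

Lemma orthonormal_coord n (w : 'I_n -> V) :
    (forall i j, f (w i) (w j) = (i == j)%:R) ->
  forall (a : 'I_n -> F) j, f (\sum_k a k *: w k) (w j) = a j.
Proof.
move=> on a j; rewrite linear_sumlz (bigD1 j) //= big1 ?addr0 => [|k /negPf kj].
  by rewrite linearZl_LR /= on eqxx mulr1.
by rewrite linearZl_LR /= on kj mulr0.
Qed.

Lemma orthonormal_basis :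
  exists w : 'I_(\dim {:V}) -> V,
    (forall i j, f (w i) (w j) = (i == j)%:R) /\
    forall x, x = \sum_i f x (w i) *: w i.
Proof.
have [s [sz on]] : exists s : seq V, size s = \dim {:V} /\
  forall i j, (i < size s)%N -> (j < size s)%N -> f s`_i s`_j = (i == j)%:R.
  have : forall k, (k <= \dim {:V})%N -> exists s : seq V, size s = k /\
    forall i j, (i < size s)%N -> (j < size s)%N -> f s`_i s`_j = (i == j)%:R.
    elim=> [|k IHk] ltk; first by exists [::].
    have [s [sz on]] := IHk (ltnW ltk).
    have [|u [uu us]] := @orthonormal_extend s _ on; first by rewrite sz.
    exists (rcons s u); rewrite size_rcons sz; split=> // i j.
    rewrite !ltnS !nth_rcons sz (leq_eqVlt i) (leq_eqVlt j).
    move=> /predU1P[->|lti] /predU1P[->|ltj].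
    - by rewrite ltnn eqxx.
    - by rewrite ltnn eqxx ltj us ?sz // gtn_eqF.
    - by rewrite ltnn eqxx lti symC us ?sz // ltn_eqF.
    - by rewrite lti ltj on ?sz.
  by move/(_ _ (leqnn _)).
exists (fun i => s`_i); split=> [i j|x]; first by rewrite on ?sz.
have frs : free s.
  rewrite -[s]in_tupleE; apply/freeP => k sum0 i.
  have := congr1 (f^~ s`_i) sum0; rewrite linear0l linear_sumlz /= (bigD1 i) //=.
  rewrite linearZl_LR /= on // eqxx mulr1 big1 ?addr0 // => j.
  by rewrite -val_eqE linearZl_LR /= on // => /negPf->; rewrite mulr0.
have bas : basis_of fullv s by rewrite basisEfree frs subvf sz leqnn.
have xs : x \in <<s>>%VS by rewrite (span_basis bas) memvf.
have := coord_span (X := in_tuple s) xs; rewrite /= => Ex.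
rewrite [LHS]Ex -sz; apply: eq_bigr => i _; congr (_ *: _).
rewrite [in RHS]Ex linear_sumlz /= (bigD1 i) //= linearZl_LR /= on // eqxx mulr1.
rewrite big1 ?addr0 // => j.
by rewrite -val_eqE linearZl_LR /= on // => /negPf->; rewrite mulr0.
Qed.

(** For such [v], 1/2 + v and 1/2 - v are idempotents of the Jordan algebra. *)
Lemma norm_quarter_exists : (0 < \dim {:V})%N -> exists v, f v v = 4^-1.
Proof.
move=> N0; have [w [on _]] := orthonormal_basis.
exists (2^-1 *: w (Ordinal N0)); rewrite linearZl_LR linearZr_LR /= on eqxx mulr1.
by field; rewrite ?two_neq0 ?(four_neq0 two_neq0).
Qed.

End Orthonormal.

(** * The index from two consecutive bounds *)

Section RotaBaxterIndex.
Variables (F : fieldType) (A : lmodType F) (mul : {bilinear A -> A -> A}).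
Variable lam : F.

Lemma rb_boundS m : rb_bound mul lam m -> rb_bound mul lam m.+1.
Proof.
move=> bm R /bm[k lekm Rk]; exists k; first exact: leqW.
by move=> x; rewrite subSn // iterSr Rk.
Qed.

(** Bounds are upward closed, so failure at [m] excludes every smaller value. *)
Lemma rb_index_eq m :
  rb_bound mul lam m.+1 -> ~ rb_bound mul lam m -> rb_index mul lam = Some m.+1.
Proof.
move=> bm nbm; rewrite /rb_index; case: pselect => [e|[]]; last by exists m.+1.
case: ex_minnP => k /asboolP bk kmin; congr Some; apply/eqP.
rewrite eqn_leq kmin; last exact/asboolP.
rewrite ltnNge; apply/negP => lekm; apply: nbm.
elim: m lekm {bm} => [|m IHm]; first by rewrite leqn0 => /eqP <-.
by rewrite leq_eqVlt => /predU1P[<-//|/IHm]; exact: rb_boundS.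
Qed.

End RotaBaxterIndex.

(** * Upper bounds *)

Section UpperBounds.
Variables (F : closedFieldType) (V : vectType F) (f : {symmetric V}).
Local Notation J := (F^o * V)%type.
Local Notation mul := (jordan_mul f).
Local Notation jone := ((1, 0) : J).
Hypothesis two_neq0 : (2 : F) != 0.
Variables (lam : F) (lam_neq0 : lam != 0).

Lemma rb_bound3 : rb_bound mul lam 3.
Proof.
move=> R RB; have [RS0|[u [_ Ru] RSu]] := rb_comp_in_line two_neq0 lam_neq0 RB.
  (* [k] selects R^k S^(3-k): R S^2 if R S = 0 or [S] kills the line, R^2 S if [R] kills it. *)
  by exists 1 => // x; exact: RS0.
have RSC x := rb_shift_comm lam R x.
case: Ru => u0.
  exists 2 => // x; have [k e] := RSu x.
  by rewrite [LHS](congr1 R e) linearZ_LR u0 scaler0.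
exists 1 => // x; have [k e] := RSu x.
rewrite [LHS](RSC (rb_shift lam R x)) e.
by rewrite (linearZ_LR (rb_shift lam R)) u0 scaler0.
Qed.

Hypothesis f_nondeg : nondegenerate f.

(** Image and kernel are totally isotropic for the norm, so each has at most half the dimension of
    [J]. As their dimensions add up to dim V + 1, both are exactly half of it. *)
Lemma isotropic_im_ker_odd (T : {linear J -> J}) :
    (forall x y, ((T x).1 : F) * (T y).1 = f (T x).2 (T y).2) ->
    (forall x y, T x = 0 -> T y = 0 -> (x.1 : F) * y.1 = f x.2 y.2) ->
  odd (\dim {:V}).
Proof.
move=> im_iso ker_iso; have [w [on ww]] := orthonormal_basis two_neq0 f_nondeg.
have [i ii] := sqrt_exists (-1 : F).
have i0 : i != 0.
  by apply: contra_eq_neq ii => ->; rewrite mul0r eq_sym oppr_eq0 oner_eq0.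
set N := \dim _ in w on ww *.
(* The factor [i] turns the norm a^2 - f u u into a sum of squares, so that its polar form becomes
   the dot product of rows. *)
pose c (x : J) : 'rV[F]_N.+1 :=
  \row_j if unlift ord0 j is Some k then i * f x.2 (w k) else x.1.
pose c' (r : 'rV[F]_N.+1) : J :=
  (r 0 ord0, \sum_k (i^-1 * r 0 (lift ord0 k)) *: w k).
have cD a x y : c (a *: x + y) = a *: c x + c y.
  apply/rowP => j; rewrite !mxE; case: unliftP => // k _ /=.
  by rewrite linearDl /= linearZl_LR /= mulrDr mulrCA.
have c'D a x y : c' (a *: x + y) = a *: c' x + c' y.
  apply: injective_projections => /=; first by rewrite !mxE.
  rewrite scaler_sumr -big_split; apply: eq_bigr => k _.
  by rewrite !mxE /= scalerA -scalerDl mulrDr mulrCA.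
have coordw := orthonormal_coord on.
have cK x : c' (c x) = x.
  apply: injective_projections => /=; first by rewrite mxE unlift_none.
  rewrite [RHS]ww; apply: eq_bigr => k _.
  by rewrite mxE liftK mulKf.
have c'K r : c (c' r) = r.
  apply/rowP => j; rewrite !mxE; case: unliftP => [k|] -> //=.
  by rewrite coordw mulVKf.
have cdot x y : c x *m (c y)^T = ((x.1 : F) * y.1 - f x.2 y.2)%:M.
  rewrite [LHS]mx11_scalar mxE big_ord_recl !mxE unlift_none; congr (_ + _)%:M.
  rewrite [y.2 in RHS]ww linear_sumr -sumrN; apply: eq_bigr => k _.
  rewrite !mxE liftK linearZr_LR /= mulrACA ii mulN1r.
  by rewrite [in RHS]mulrC.
(* Isotropy of the row space reads A A^T = 0, which bounds rank A + rank A^T by N + 1. *)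
have iso m (A : 'M_(m, N.+1)) :
    (forall k l, row k A *m (row l A)^T = 0) -> (2 * \rank A <= N.+1)%N.
  move=> A0; rewrite mul2n -addnn -{2}mxrank_tr; apply: mulmx0_rank_max.
  apply/matrixP => k l; have /matrixP/(_ 0 0) := A0 k l.
  by rewrite !mxE => e; rewrite -[RHS]e; apply: eq_bigr => j _; rewrite !mxE.
have gl : linear (fun r => c (T (c' r))).
  by move=> a x y; rewrite c'D linearP cD.
pose G : {linear 'rV[F]_N.+1 -> 'rV[F]_N.+1} :=
  HB.pack (fun r => c (T (c' r))) (GRing.isLinear.Build _ _ _ _ _ gl).
pose M := lin1_mx G.
have rM r : r *m M = c (T (c' r)) by rewrite mul_rV_lin1.
have : (2 * \rank M <= N.+1)%N.
  by apply: iso => k l; rewrite !rowE !rM cdot im_iso subrr raddf0.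
have : (2 * \rank (kermx M) <= N.+1)%N.
  have kerT k : T (c' (row k (kermx M))) = 0.
    rewrite -[LHS]cK -rM -row_mul mulmx_ker row0.
    apply: injective_projections; rewrite /= ?mxE // big1 // => j _.
    by rewrite mxE mulr0 scale0r.
  apply: iso => k l; rewrite -[row k _]c'K -[row l _]c'K cdot ker_iso //.
  by rewrite subrr raddf0.
rewrite mxrank_ker mulnBr => h1 h2.
have e : (2 * \rank M = N.+1)%N.
  apply/eqP; rewrite eqn_leq h2 /=; move: h1.
  by rewrite leq_subLR mul2n -addnn leq_add2r.
by have := congr1 odd e; rewrite oddM /= => /esym/negbFE.
Qed.

Lemma rb_bound2 : ~~ odd (\dim {:V}) -> rb_bound mul lam 2.
Proof.
move=> evN R RB; exists 1 => // x; rewrite -[LHS]/(R (rb_shift lam R x)).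
set S := rb_shift lam R.
have [//|[u [u2 _] RSu]] := rb_comp_in_line two_neq0 lam_neq0 RB.
have dR a b : mul (R a) (R b) = R (rb_dot mul lam R a b) by exact: rb_dotR.
have dS a b : mul (S a) (S b) = S (rb_dot mul lam R a b) by exact: rb_dotS.
(* For [T] equal to [R] or [S]: if image and kernel both missed 1, both would be totally isotropic
   and dim V odd. *)
have split (T : {linear J -> J}) :
    (forall a b, exists d, mul (T a) (T b) = T d) ->
    (forall a b, T a = 0 -> T b = 0 -> T (mul a b) = 0) ->
  T jone = 0 \/ exists y, T y = jone.
  move=> imM kerM; apply: contrapT => /not_orP[k1 i1]; move/negP: evN; apply.
  apply: (isotropic_im_ker_odd (T := T)).
    move=> a b; apply: (subalgebra_isotropic two_neq0
      (B := fun z => exists t, T t = z)); [| | |by []|by exists a|by exists b].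
    - by move=> _ _ [p <-] [q <-]; exists (p + q); rewrite linearD.
    - by move=> k _ [p <-]; exists (k *: p); rewrite linearZ_LR.
    - by move=> _ _ [p <-] [q <-]; have [d ->] := imM p q; exists d.
  apply: (subalgebra_isotropic two_neq0) => //.
  - by move=> p q p0 q0; rewrite linearD p0 q0 addr0.
  - by move=> k p p0; rewrite linearZ_LR p0 scaler0.
have ideR (a b : J) : R a = 0 -> R (mul a (S b)) = 0 by exact: ker_rb_ideal.
have ideS (a b : J) : S a = 0 -> S (mul a (R b)) = 0.
  by rewrite mulJC; exact: ker_shift_ideal.
have mulZr (k : F) (a b : J) : mul a (k *: b) = k *: mul a b by exact: linearZr_LR.
have splitS : S jone = 0 \/ exists y, S y = jone.
  apply: split => [a b|a b a0 b0]; first by (eexists; exact: dS).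
  (* On ker S the operator [R] is -lam, so the ideal property makes ker S closed under products. *)
  have Rb : R b = - lam *: b.
    by apply: (addIr (lam *: b)); rewrite [LHS]b0 scaleNr addNr.
  have := ideS a b a0; rewrite Rb mulZr (linearZ_LR S) => /eqP.
  by rewrite scaler_eq0 oppr_eq0 (negPf lam_neq0) => /eqP.
have splitR : R jone = 0 \/ exists y, R y = jone.
  apply: split => [a b|a b a0 b0]; first by (eexists; exact: dR).
  have Sb : S b = lam *: b by rewrite /S rb_shiftE b0 add0r.
  have := ideR a b a0; rewrite Sb mulZr linearZ_LR => /eqP.
  by rewrite scaler_eq0 (negPf lam_neq0) => /eqP.
have [R1|[y Ry]] := splitR; first by rewrite -[S x](mul1J f) ideR.
have [S1|[z Sz]] := splitS.
  by rewrite rb_shift_comm -[R x](mul1J f) ideS.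
(* Now 1 lies in both images, hence in the image of [R S], a line whose generator is not a
   scalar. *)
have [|t Rt] := @rb_image_cap _ _ lam R y z lam_neq0; first by rewrite Ry -Sz.
have [k kE] := RSu t; move: Rt; rewrite Ry kE => E.
have /eqP := congr1 snd E; rewrite /= eq_sym scaler_eq0 (negPf u2) orbF => /eqP k0.
by have /eqP := congr1 fst E; rewrite k0 scale0r /= oner_eq0.
Qed.
End UpperBounds.

(** * Lower bounds from explicit operators *)

Section LowerBounds.
Variables (F : closedFieldType) (V : vectType F) (f : {symmetric V}).
Local Notation J := (F^o * V)%type.
Local Notation mul := (jordan_mul f).
Local Notation jone := ((1, 0) : J).
Hypothesis two_neq0 : (2 : F) != 0.
Variables (lam : F) (lam_neq0 : lam != 0).

Let four_neq0 : (4 : F) != 0 := four_neq0 two_neq0.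

(** The projection is onto the line of the idempotent 1/2 + v, along F 1 + v^perp. Both summands are
    subalgebras, which is why -lam times it is a Rota-Baxter operator. *)
Lemma not_rb_bound1 (v : V) : f v v = 4^-1 -> ~ rb_bound mul lam 1.
Proof.
move=> fvv.
pose g (x : J) : J := (- lam * (4 * f x.2 v)) *: ((2^-1, v) : J).
have gl : linear g.
  move=> a x y; rewrite /g /= linearDl linearZl_LR /= scalerA -scalerDl.
  congr (_ *: _); ring.
pose R : {linear J -> J} := HB.pack g (GRing.isLinear.Build _ _ _ _ _ gl).
have RE x : R x = g x by [].
have RB : rota_baxter mul lam R.
  move=> [a u] [b w]; rewrite !RE /g /=.
  have -> : mul ((- lam * (4 * f u v)) *: (2^-1, v))
                ((- lam * (4 * f w v)) *: (2^-1, v)) =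
      ((- lam * (4 * f u v)) * (- lam * (4 * f w v))) *: ((2^-1, v) : J).
    apply: injective_projections => /=.
      rewrite linearZl_LR linearZr_LR /= fvv /GRing.scale /=.
      by move: (f u v) (f w v) => p q; field; rewrite ?two_neq0 ?four_neq0.
    rewrite !scalerA -scalerDl /GRing.scale /=; congr (_ *: _).
    by move: (f u v) (f w v) => p q; field; rewrite ?two_neq0 ?four_neq0.
  congr (_ *: _); rewrite !linearDl !linearZl_LR /= !linearDl !linearZl_LR /= fvv.
  rewrite /GRing.scale /=; move: (f u v) (f w v) (a : F) (b : F) => p q a' b'.
  by field; rewrite ?two_neq0 ?four_neq0.
case/(_ R RB) => -[|[|//]] _ H.
  have /(congr1 fst)/eqP := H jone.
  rewrite -[iter _ _ _]/(g jone + lam *: jone) /= linear0l /GRing.scale /=.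
  by rewrite !mulr0 mul0r add0r mulr1 (negPf lam_neq0).
have /(congr1 fst)/eqP := H (0, v); rewrite -[iter _ _ _]/(g (0, v)) /= fvv.
by rewrite /GRing.scale /= mulfV // mulr1 mulf_eq0 oppr_eq0 invr_eq0
  (negPf lam_neq0) (negPf two_neq0).
Qed.

(** On v^perp, [P] is a projection whose sum with its adjoint is the identity, so its image and
    kernel there are isotropic. With e = 1/2 + v and e' = 1/2 - v, [R] sends e to lam e', kills e'
    and is -lam P on v^perp. *)
Lemma not_rb_bound2 (v : V) (P : {linear V -> V}) : f v v = 4^-1 -> P v = 0 ->
    (forall x, P (P x) = P x) -> (forall x, f (P x) v = 0) ->
    (forall x y, f (P x) y + f x (P y) = f x y - 4 * (f x v * f y v)) ->
    (exists x, P x != 0) -> ~ rb_bound mul lam 2.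
Proof.
move=> fvv Pv PP fPv fP [t Pt].
have fPP x y : f (P x) (P y) = 0.
  have := fP x (P y); rewrite PP fPv !mulr0 subr0 -[RHS]add0r.
  exact: addIr.
(* The coordinate along e: it is 1 on e and 0 on e' and v^perp. *)
pose phi (x : J) : F := x.1 + 2 * f x.2 v.
pose g (x : J) : J := lam *: (phi x *: ((2^-1, - v) : J) - (0, P x.2)).
have phil a x y : phi (a *: x + y) = a * phi x + phi y.
  by rewrite /phi /= linearDl linearZl_LR /= /GRing.scale /=; ring.
have gl : linear g.
  move=> a x y; rewrite /g phil [a *: (lam *: _)]scalerA [a * lam]mulrC.
  rewrite -[(lam * a) *: _]scalerA -scalerDr; congr (_ *: _).
  rewrite scalerBr scalerA addrACA -scalerDl -opprD; congr (_ - _).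
  by apply: injective_projections; rewrite /= ?linearP // scaler0 addr0.
pose R : {linear J -> J} := HB.pack g (GRing.isLinear.Build _ _ _ _ _ gl).
have RE x : R x = g x by [].
have RB : rota_baxter mul lam R.
  have g1 x : (g x).1 = lam * (phi x * 2^-1) :> F by rewrite /= subr0.
  have g2 x : (g x).2 = (- (lam * phi x)) *: v + (- lam) *: P x.2.
    by rewrite /= scalerBr scalerA scalerN !scaleNr.
  have Pg x : P (g x).2 = - lam *: P x.2.
    by rewrite g2 linearD !(linearZ_LR P) Pv scaler0 add0r PP.
  have fgv x : f (g x).2 v = - (lam * phi x) * 4^-1.
    by rewrite g2 linearDl !linearZl_LR /= fPv mulr0 addr0 fvv.
  move=> x y; rewrite !RE; set z := _ + _ + _.
  pose p := phi x; pose q := phi y.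
  (* [R z] depends only on [phi z] and [P z.2], which are computed next; [G] and [H] keep the vector
     parts of [g x] and [g y] from unfolding. *)
  have [G [GE PG]] : exists G, (g x).2 = G /\ P G = - lam *: P x.2.
    by exists (g x).2; rewrite Pg.
  have [H [HE PH]] : exists H, (g y).2 = H /\ P H = - lam *: P y.2.
    by exists (g y).2; rewrite Pg.
  have z1 : z.1 = lam * (p * 2^-1) * y.1 + f G y.2 +
      ((x.1 : F) * (lam * (q * 2^-1)) + f x.2 H) + lam * (x.1 * y.1 + f x.2 y.2).
    by rewrite -GE -HE -!g1.
  have z2 : z.2 = (lam * (p * 2^-1)) *: y.2 + (y.1 : F) *: G +
      ((x.1 : F) *: H + (lam * (q * 2^-1)) *: x.2) +
      lam *: ((x.1 : F) *: y.2 + (y.1 : F) *: x.2).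
    by rewrite -GE -HE -!g1.
  have fGv : f G v = - (lam * p) * 4^-1 by rewrite -GE fgv.
  have fHv : f H v = - (lam * q) * 4^-1 by rewrite -HE fgv.
  have fG t' : f G t' = - (lam * p) * f v t' - lam * f (P x.2) t'.
    by rewrite -GE g2 linearDl !linearZl_LR /= !mulNr.
  have fH t' : f t' H = - (lam * q) * f t' v - lam * f t' (P y.2).
    by rewrite -HE g2 linearDr !linearZr_LR /= !mulNr.
  have zphi : phi z = lam * (p * q).
    rewrite /phi z1 z2 !linearDl !linearZl_LR /= !linearDl !linearZl_LR /= fGv fHv.
    rewrite fG fH (symC f v) /p /q /phi.
    have := fP x.2 y.2.
    move: (f (P x.2) y.2) (f x.2 (P y.2)) (f x.2 y.2) => k l m.
    move: (f x.2 v) (f y.2 v) (x.1 : F) (y.1 : F) => p' q' a b E.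
    have {k E}-> : k = m - 4 * (p' * q') - l by rewrite -E addrK.
    by field; rewrite ?two_neq0 ?four_neq0.
  have zP : P z.2 = (lam * (p * 2^-1)) *: P y.2 + (lam * (q * 2^-1)) *: P x.2.
    rewrite z2 !(linearD P) !(linearZ_LR P) !(linearD P) !(linearZ_LR P) PG PH.
    rewrite scalerDr !scalerA.
    rewrite [X in X + _]addrACA -!scalerDl addrACA -!scalerDl.
    by congr (_ *: _ + _ *: _); move: (x.1 : F) (y.1 : F) => a b; ring.
  apply: injective_projections.
    rewrite [in RHS]g1 zphi.
    rewrite [LHS](_ : _ = ((g x).1 : F) * (g y).1 + f (g x).2 (g y).2) //.
    rewrite !g1 GE HE fH fGv fG (symC f v) fPv fPP.
    by rewrite /p /q; field; rewrite ?two_neq0 ?four_neq0.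
  rewrite [RHS]g2 zphi zP.
  rewrite [LHS](_ : _ = ((g x).1 : F) *: (g y).2 + ((g y).1 : F) *: (g x).2) //.
  rewrite !g1 !g2 !scalerDr !scalerA addrACA -!scalerDl /p /q.
  by congr (_ *: _ + (_ *: _ + _ *: _)); field; rewrite ?two_neq0 ?four_neq0.
have phie : phi (2^-1, v) = 1.
  by rewrite /phi /= fvv; field; rewrite ?two_neq0 ?four_neq0.
have phie' : phi (2^-1, - v) = 0.
  by rewrite /phi /= linearNl /= fvv; field; rewrite ?two_neq0 ?four_neq0.
pose e' : J := (2^-1, - v).
have Re : R (2^-1, v) = lam *: e' by rewrite RE /g phie Pv scale1r subr0.
have Re' : R e' = 0.
  by rewrite RE /g phie' /= (linearN P) Pv oppr0 scale0r subr0 scaler0.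
have e'0 : lam *: e' != 0.
  rewrite scaler_eq0 (negPf lam_neq0); apply/eqP => /(congr1 fst)/eqP.
  by rewrite /= invr_eq0; exact/negP.
have Rt : R (0, P t) = - lam *: ((0, P t) : J).
  rewrite RE /g /phi /= fPv mulr0 addr0 scale0r PP.
  by rewrite add0r scalerN scaleNr.
(* S^2 is nonzero on e', R S on e, and R^2 on the image of [P]. *)
case/(_ R RB) => -[|[|[|//]]] _ H.
- have := H e'.
  rewrite -[iter _ _ _]/(R (R e' + lam *: e') + lam *: (R e' + lam *: e')).
  rewrite Re' add0r linearZ_LR Re' scaler0 add0r => /eqP.
  by rewrite scaler_eq0 (negPf lam_neq0) (negPf e'0).
- have := H (2^-1, v).
  rewrite -[iter _ _ _]/(R (R (2^-1, v) + lam *: (2^-1, v))).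
  rewrite (linearD R) Re !(linearZ_LR R) Re Re' scaler0 add0r => /eqP.
  by rewrite scaler_eq0 (negPf lam_neq0) (negPf e'0).
have := H (0, P t); rewrite -[iter _ _ _]/(R (R (0, P t))).
rewrite Rt linearZ_LR Rt => /eqP; rewrite !scaler_eq0 oppr_eq0 (negPf lam_neq0) /=.
by move=> /eqP/(congr1 snd)/eqP; exact/negP.
Qed.

End LowerBounds.

(** * Lagrangian projections in odd dimension *)

Section Lagrangian.
Variables (F : closedFieldType) (V : vectType F) (f : {symmetric V}).
Hypotheses (two_neq0 : (2 : F) != 0) (f_nondeg : nondegenerate f).

(* Fixes 0 and exchanges 2k+1 with 2k+2. *)
Definition swap_pairs (i : nat) : nat :=
  if i is j.+1 then (if odd j then j else j.+2) else 0.

Lemma swap_pairsK : involutive swap_pairs.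
Proof. by case=> // -[|i] //=; case oi: (odd i) => //=; rewrite ?oi. Qed.

(** For [N] odd the last index is even, so no pair is cut at [N]. *)
Lemma swap_pairs_lt N i : odd N -> (i < N)%N -> (swap_pairs i < N)%N.
Proof. by case: i => // i oN; rewrite /swap_pairs; case: ifP; lia. Qed.

Lemma lagrangian_projection : odd (\dim {:V}) -> (1 < \dim {:V})%N ->
  exists v (P : {linear V -> V}), [/\ f v v = 4^-1 /\ P v = 0,
    forall x, P (P x) = P x, forall x, f (P x) v = 0,
    forall x y, f (P x) y + f x (P y) = f x y - 4 * (f x v * f y v)
    & exists x, P x != 0].
(* In an orthonormal basis w with i^2 = -1, v = w_0 / 2 and P projects v^perp
   onto the span of the w_(2k+1) - i w_(2k+2). *)
Proof.
move=> oddN N1; have [w [on ww]] := orthonormal_basis two_neq0 f_nondeg.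
have [i ii] := sqrt_exists (-1 : F).
have four_neq0 := four_neq0 two_neq0.
set N := \dim _ in w on ww oddN N1.
pose sw (j : 'I_N) : 'I_N := Ordinal (swap_pairs_lt oddN (ltn_ord j)).
have swK : involutive sw by move=> j; apply: val_inj; exact: swap_pairsK.
pose d (j : 'I_N) : F := (j != 0 :> nat)%:R.
pose s (j : 'I_N) : F := if j == 0 :> nat then 0 else (-1) ^+ (odd j).
have ds j : d (sw j) = d j by rewrite /d /sw; case: j => -[|[|j]] //= _; case: ifP.
have dd j : d j * d j = d j by rewrite /d; case: eqP; rewrite ?mulr0 ?mulr1.
have s_s j : s (sw j) = - s j.
  rewrite /s /sw; case: j => -[|[|j]] lj /=; first by rewrite oppr0.
    by rewrite expr0 opprK.
  by case oj: (odd j); rewrite /= ?oj //= expr0 ?opprK.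
have ss j : s j * s j = d j.
  by rewrite /s /d; case: eqP => _; rewrite ?mulr0 // -expr2 sqrr_sign.
have dsj j : d j * s j = s j.
  by rewrite /s /d; case: eqP => _; rewrite ?mulr0 ?mul1r.
(* On v^perp this is P = (1 - i K)/2 with (K x)_j = s_j x_(sw j). As K is skew and K^2 = -1, P is
   idempotent and P + P^T = 1. *)
pose p x j : F := 2^-1 * (d j * f x (w j) - i * s j * f x (w (sw j))).
pose g x := \sum_j p x j *: w j.
have gl : linear g.
  move=> a x y; rewrite /g scaler_sumr -big_split; apply: eq_bigr => j _ /=.
  by rewrite scalerA -scalerDl /p !linearDl !linearZl_LR /=; congr (_ *: _); ring.
pose P : {linear V -> V} := HB.pack g (GRing.isLinear.Build _ _ _ _ _ gl).
have PE x : P x = g x by [].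
have coordw := orthonormal_coord on.
have parseval x y : f x y = \sum_j f x (w j) * f y (w j).
  rewrite {1}[y]ww linear_sumr; apply: eq_bigr => j _.
  by rewrite linearZr_LR /= mulrC.
pose o : 'I_N := Ordinal (ltnW N1).
pose o1 : 'I_N := Ordinal N1.
have fv x : f x (2^-1 *: w o) = 2^-1 * f x (w o) by rewrite linearZr_LR.
have po x : p x o = 0 by rewrite /p /d /s /= mulr0 !mul0r subr0 mulr0.
have skew x y : f (P x) y + f x (P y) = f x y - f x (w o) * f y (w o).
  have -> : f (P x) y = \sum_j p x j * f y (w j).
    by rewrite parseval; apply: eq_bigr => j _; rewrite PE coordw.
  have -> : f x (P y) = \sum_j p y j * f x (w j).
    by rewrite symC parseval; apply: eq_bigr => j _; rewrite PE coordw.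
  have -> : f x y - f x (w o) * f y (w o) = \sum_j d j * (f x (w j) * f y (w j)).
    rewrite parseval (bigD1 o) //= addrAC subrr add0r [RHS](bigD1 o) //= mul0r add0r.
    by apply: eq_bigr => j; rewrite -val_eqE /d /= => ->; rewrite mul1r.
  pose A u t := \sum_j s j * (f u (w (sw j)) * f t (w j)).
  have AN u t : A u t = - A t u.
    rewrite /A -sumrN (reindex_inj (inv_inj swK)); apply: eq_bigr => j _.
    by rewrite swK s_s mulNr [f u _ * _]mulrC.
  (* Adding a sum that vanishes by skewness lets the two sides agree term by term. *)
  have -> : \sum_j d j * (f x (w j) * f y (w j)) =
      \sum_j d j * (f x (w j) * f y (w j)) - 2^-1 * i * (A x y + A y x).
    by rewrite [A y x]AN subrr mulr0 subr0.
  rewrite -!big_split /= mulr_sumr -sumrB; apply: eq_bigr => j _.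
  by rewrite /p; field; rewrite ?two_neq0.
exists (2^-1 *: w o), P; split.
- split; first by rewrite fv linearZl_LR /= on eqxx mulr1; field; rewrite ?four_neq0.
  rewrite PE /g big1 // => j _; rewrite /p !linearZl_LR /= !on.
  have [->|jo] := eqVneq j o.
    by rewrite /d /s /= mul0r mulr0 mul0r subr0 mulr0 scale0r.
  have -> : (o == sw j) = false.
    apply/negP => /eqP/(congr1 sw); rewrite swK => e.
    by rewrite -e -val_eqE in jo.
  by rewrite !mulr0 subr0 mulr0 scale0r.
- move=> x; rewrite !PE /g; apply: eq_bigr => j _; congr (_ *: _).
  rewrite /p !coordw /p swK ds s_s.
  move: (f x (w j)) (f x (w (sw j))) => a b.
  have -> : 2^-1 * (d j * (2^-1 * (d j * a - i * s j * b)) -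
       i * s j * (2^-1 * (d j * b - i * - s j * a))) =
      2^-1 * 2^-1 *
        (d j * d j * a - 2 * i * (d j * s j) * b - i * i * (s j * s j) * a).
    by field; rewrite ?two_neq0.
  by rewrite dd dsj ss ii; field; rewrite ?two_neq0.
- by move=> x; rewrite fv PE coordw po mulr0.
- move=> x y; rewrite skew !fv; congr (_ - _).
  by field; rewrite ?two_neq0 ?four_neq0.
apply: contrapT => /forallNP P0; have {}P0 x : P x = 0.
  by apply/eqP/negPn/negP; exact: P0.
have /eqP := skew (w o1) (w o1); rewrite P0 linear0l linear0r add0r !on.
by rewrite eqxx /= mul0r subr0 eq_sym oner_eq0.
Qed.
End Lagrangian.

Unset Implicit Arguments.
Set Strict Implicit.

Theorem proposition2 (F : closedFieldType)
    (char2 : 2%N \notin [pchar F]) (char3 : 3%N \notin [pchar F])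
    (lam : F) (lam_neq0 : lam != 0)
    (n : nat) (n_ge3 : (3 <= n)%N)
    (V : vectType F) (dimV : \dim {:V} = n.-1)
    (f : {symmetric V}) (f_nondeg : nondegenerate f) :
  rb_index (jordan_mul f) lam = Some (if odd n then 2%N else 3%N).
Proof.
have two_neq0 : (2 : F) != 0 by move: char2; rewrite inE.
have oddV : odd (\dim {:V}) = ~~ odd n.
  by rewrite dimV; case: n n_ge3 {dimV} => //= m _; rewrite negbK.
have V_gt1 : (1 < \dim {:V})%N by rewrite dimV; case: n n_ge3 {dimV oddV}.
case: ifPn => n_odd; apply: rb_index_eq.
- by apply: rb_bound2 => //; rewrite oddV n_odd.
- have [v fvv] := norm_quarter_exists two_neq0 f_nondeg (ltnW V_gt1).
  exact: not_rb_bound1 fvv.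
- exact: rb_bound3.
have [|v [P [[fvv Pv] PP fPv fP nzP]]] :=
  lagrangian_projection two_neq0 f_nondeg _ V_gt1; first by rewrite oddV.
exact: not_rb_bound2 fvv Pv PP fPv fP nzP.
Qed.
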